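(* Let $n\ge 1$ and let $\mathbf{A}$ be an $n\times n$ real doubly-affine matrix with row-column sum $L$ that has a single non-zero eigenvalue (1EV), i.e. $L\neq 0$ and the characteristic equation of $\mathbf{A}$ is $x^{n}=L\,x^{n-1}$, so that its eigenvalues, counted with algebraic multiplicity, are $L$ once and $0$ with multiplicity $n-1$. Then $\mathbf{A}$ powers up to constant matrices: there exists a positive integer $p$ such that for every integer $q\ge p$ the matrix power $\mathbf{A}^{q}$ is a constant matrix.
   Context: A square matrix is doubly-affine (DA) with row-column sum (linesum, or magic constant) $L$ if the entries of each row sum to $L$ and the entries of each column sum to $L$; no condition is imposed on the diagonals. Examples are Latin squares (with numerical symbols), semimagic squares and magic squares. A constant matrix is a matrix all of whose entries are equal, i.e. a matrix of the form $c\,\mathbf{E}_n$, where $c$ is a scalar and $\mathbf{E}_n$ is the $n\times n$ matrix of all ones. Powers $\mathbf{A}^q$ are ordinary matrix powers. *)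

(* Defs.v *)
From mathcomp Require Import all_boot all_order all_algebra.
From mathcomp Require Import reals.

Set Implicit Arguments.
Unset Strict Implicit.
Unset Printing Implicit Defensive.

Import GRing.Theory.
Local Open Scope ring_scope.

Definition doubly_affine (R : nzRingType) (n : nat) (L : R) (A : 'M[R]_n) :
    Prop :=
  (forall i : 'I_n, \sum_(j < n) A i j = L) /\
  (forall j : 'I_n, \sum_(i < n) A i j = L).

(* The characteristic equation is x^n = L x^(n-1) with L nonzero; n.-1 is
   truncated, so this is only meant for 0 < n. *)
Definition single_nonzero_eigenvalue (R : nzRingType) (n : nat) (L : R)
    (A : 'M[R]_n) : Prop :=
  L != 0 /\ char_poly A = 'X^n - L *: 'X^(n.-1).

Definition constant_matrix (R : nzRingType) (n : nat) (A : 'M[R]_n) : Prop :=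
  exists c : R, A = c *: const_mx 1.

(* Main.v *)
Require Import Defs.
From mathcomp Require Import all_boot all_order all_algebra.
From mathcomp Require Import reals.

(** The matrix [K], all of whose entries are [L / n], carries the whole
    non-zero part of the spectrum of [A].  Double affinity says that the
    all-ones vector is both a right and a left eigenvector of [A] for [L];
    hence [A *m K = K *m A = L *: K], and also [K *m K = L *: K], so that [K]
    and [A - K] annihilate each other.  Therefore [A ^+ q] is
    [(A - K) ^+ q + K ^+ q] for [0 < q], and [K ^+ q] is constant.

    It remains to see that [A - K] is nilpotent.  By Brauer's theorem
    ([char_poly_sub_eigencol]), subtracting the rank-one matrix [K], whose
    column is an eigenvector of [A] for [L], moves the eigenvalue [L] to
    [L - \tr K = 0] and leaves the others as they are.  As the others are all
    zero, [char_poly (A - K) = 'X^n], and the Cayley-Hamilton theorem gives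
    [(A - K) ^+ n = 0].  So [p = n] works. *)

Local Open Scope ring_scope.
Import GRing.Theory Num.Theory.

(** Brauer's theorem, with denominators cleared.  The bordered matrix
    [block_mx ('X - A) u (- v) 1] has determinant [char_poly (A - u *m v)],
    by eliminating its last row with the entry 1.  As
    [('X - A) *m u = ('X - L) *: u], its last column can instead be cleared
    above the corner after a scaling by ['X - L], which leaves
    ['X - L + v *m u] in the corner. *)
Lemma char_poly_sub_eigencol {R : comNzRingType} {n : nat} {L : R}
    {A : 'M[R]_n} {u : 'cV[R]_n} (v : 'rV[R]_n) :
  A *m u = L *: u ->
  char_poly (A - u *m v) * ('X - L%:P) =
    char_poly A * ('X - L%:P + ((v *m u) 0 0)%:P).
Proof.
move=> Au.
set U := map_mx polyC u; set V := map_mx polyC v.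
pose M := block_mx (char_poly_mx A) U (- V) 1%:M.
have detM : \det M = char_poly (A - u *m v).
  have : M *m block_mx 1%:M 0 V 1%:M =
      block_mx (char_poly_mx (A - u *m v)) U 0 1%:M.
    rewrite mulmx_block !mulmx0 !mulmx1 !mul1mx !add0r addNr; congr block_mx.
    by rewrite /char_poly_mx map_mxB map_mxM opprB addrA addrAC.
  move/(congr1 determinant).
  by rewrite det_mulmx det_lblock det_ublock !det1 !mulr1.
have char_mxU : char_poly_mx A *m U = ('X - L%:P) *: U.
  by rewrite mulmxBl mul_scalar_mx -map_mxM Au map_mxZ scalerBl.
have : M *m block_mx 1%:M (- U) 0 ('X - L%:P)%:M =
    block_mx (char_poly_mx A) 0 (- V) ('X - L%:P + ((v *m u) 0 0)%:P)%:M.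
  rewrite mulmx_block !mulmx0 !mulmx1 !mul1mx !addr0; congr block_mx.
    by rewrite mulmxN char_mxU mul_mx_scalar addNr.
  rewrite mulNmx mulmxN opprK -map_mxM [v *m u]mx11_scalar map_scalar_mx.
  by rewrite -raddfD addrC !mxE mulr1n.
move/(congr1 determinant).
by rewrite det_mulmx det_ublock det_lblock det1 mul1r !det_scalar1 detM.
Qed.

Lemma exprSD_mul0 {R : pzRingType} {x y : R} (q : nat) :
  x * y = 0 -> y * x = 0 -> (x + y) ^+ q.+1 = x ^+ q.+1 + y ^+ q.+1.
Proof.
move=> xy0 yx0; elim: q => [|q IHq]; first by rewrite !expr1.
rewrite exprS IHq mulrDl !mulrDr -!exprS.
by rewrite [y ^+ q.+1]exprS [x ^+ q.+1]exprS !mulrA xy0 yx0 !mul0r addr0 add0r.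
Qed.

Lemma char_poly_Xn_nilpotent {R : comNzRingType} {n : nat} {C : 'M[R]_n.+1} :
  char_poly C = 'X^(n.+1) -> C ^+ n.+1 = 0.
Proof.
by move=> charC; rewrite -(Cayley_Hamilton C) charC rmorphXn /= horner_mx_X.
Qed.

Theorem proposition2 (R : realType) (n : nat) (hn : (1 <= n)%N) (L : R)
    (A : 'M[R]_n) (hDA : doubly_affine L A)
    (h1EV : single_nonzero_eigenvalue L A) :
  exists p : nat, (0 < p)%N /\
    forall q : nat, (p <= q)%N -> constant_matrix (A ^+ q).
Proof.
case: n hn A hDA h1EV => // n _ A [rowsA colsA] [_ charA].
pose c : R := L / n.+1%:R.
pose u : 'cV[R]_n.+1 := const_mx 1.
pose v : 'rV[R]_n.+1 := const_mx c.
pose K := u *m v.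
have Au : A *m u = L *: u.
  apply/matrixP => i j; rewrite !mxE mulr1 -(rowsA i).
  by apply: eq_bigr => k _; rewrite mxE mulr1.
have vA : v *m A = L *: v.
  apply/matrixP => i j; rewrite !mxE -(colsA j) mulr_suml.
  by apply: eq_bigr => k _; rewrite mxE mulrC.
have vu : v *m u = L%:M.
  apply/matrixP => i j; rewrite !ord1 !mxE mulr1n.
  under eq_bigr do rewrite !mxE mulr1.
  by rewrite sumr_const card_ord -mulr_natr divfK // pnatr_eq0.
have KK : K *m K = L *: K.
  by rewrite /K mulmxA -(mulmxA u) vu mul_mx_scalar -scalemxAl.
have CK0 : (A - K) *m K = 0.
  by rewrite mulmxBl KK {1}/K mulmxA Au -scalemxAl subrr.
have KC0 : K *m (A - K) = 0.
  by rewrite mulmxBr KK {1}/K -mulmxA vA -scalemxAr subrr.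
have C_nil : (A - K) ^+ n.+1 = 0.
  apply: char_poly_Xn_nilpotent.
  apply: (mulIf (negbT (polyXsubC_eq0 L))).
  rewrite (char_poly_sub_eigencol v Au) charA vu !mxE mulr1n subrK.
  by rewrite mulrBl mulrBr -scalerAl -!exprSr [_ * L%:P]mulrC mul_polyC.
have Kexp q : K ^+ q.+1 = L ^+ q *: K.
  elim: q => [|q IHq]; first by rewrite expr1 scale1r.
  by rewrite exprS IHq -scalerAr -mulmxE KK scalerA -exprSr.
exists n.+1; split=> // -[//|q] le_nq; exists (L ^+ q * c).
rewrite -(subrK K A) (exprSD_mul0 q CK0 KC0) Kexp -(subnK le_nq) exprD C_nil.
rewrite mulr0 add0r; apply/matrixP => i j.
by rewrite !mxE big_ord1 !mxE mul1r mulr1.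
Qed.
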